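(* For every positive integer $n$ there is a finite distributive lattice $L$ such that every finite graph $G$ with $\mathrm{End}(G)\cong(L,\wedge)$ contains the hypercube graph $Q_n$ as a minor. In particular, no class of graphs excluding a (fixed) minor is $\mathrm{End}$-universal for commutative idempotent monoids.
   Context: $\mathrm{End}(G)$ denotes the monoid under composition of endomorphisms of the undirected graph $G$ (vertex maps sending edges to edges); a lattice $L$ is regarded as the monoid $(L,\wedge)$. A class of graphs $\mathcal G$ is $\mathrm{End}$-universal for a class of monoids $\mathcal M$ if every $M\in\mathcal M$ is isomorphic to $\mathrm{End}(G)$ for some $G\in\mathcal G$. A class excludes a minor if there is a graph $H$ that is not a minor of any graph in the class. All graphs and monoids are finite. *)

(* Defs.v *)
From HB Require Import structures.
From mathcomp Require Import all_boot all_order.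

Set Implicit Arguments.
Unset Strict Implicit.
Unset Printing Implicit Defensive.

Import Order.LTheory.

#[short(type="finMonoidType")]
HB.structure Definition FinMonoid := {M of Monoid M & Finite M}.

Definition monoid_iso (M N : monoidType) : Prop :=
  exists2 phi : M -> N, monoid_morphism phi & bijective phi.

Definition comm_idem_monoid (M : finMonoidType) : Prop :=
  commutative (@mul M) /\ idempotent_op (@mul M).

Definition meet_monoid (d : Order.disp_t) (L : finTBLatticeType d) : Type := L.

Section MeetMonoid.
Context (d : Order.disp_t) (L : finTBLatticeType d).

HB.instance Definition _ := Finite.copy (meet_monoid L) L.
HB.instance Definition _ := isMonoid.Build (meet_monoid L)
  (@meetA d L) (@meet1x d L) (@meetx1 d L).

End MeetMonoid.

Record sgraph : Type := SGraph {
  vertex :> finType;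
  edge : rel vertex;
  edge_sym : symmetric edge;
  edge_irrefl : irreflexive edge
}.

Section Endomorphisms.
Variable G : sgraph.

Definition is_endo (f : {ffun G -> G}) : bool :=
  [forall x, forall y, edge x y ==> edge (f x) (f y)].

Record endo : Type := Endo { endo_fun :> {ffun G -> G}; _ : is_endo endo_fun }.

HB.instance Definition _ := [isSub for endo_fun].
HB.instance Definition _ := [Finite of endo by <:].

Lemma is_endoP (f : {ffun G -> G}) :
  reflect (forall x y, edge x y -> edge (f x) (f y)) (is_endo f).
Proof.
apply: (iffP forallP) => [h x y xy | h x].
  by have /forallP/(_ y)/implyP := h x; apply.
by apply/forallP => y; apply/implyP; apply: h.
Qed.

Lemma endo_id_subproof : is_endo [ffun x => x].
Proof. by apply/is_endoP => x y; rewrite !ffunE. Qed.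

Lemma endo_comp_subproof (f g : endo) : is_endo [ffun x => f (g x)].
Proof.
have /is_endoP hf := valP f; have /is_endoP hg := valP g.
by apply/is_endoP => x y xy; rewrite !ffunE; apply/hf/hg.
Qed.

Definition endo_id : endo := Endo endo_id_subproof.
Definition endo_comp (f g : endo) : endo := Endo (endo_comp_subproof f g).

Lemma endo_compA : associative endo_comp.
Proof. by move=> f g h; apply/val_inj/ffunP => x; rewrite !ffunE. Qed.

Lemma endo_comp1f : left_id endo_id endo_comp.
Proof. by move=> f; apply/val_inj/ffunP => x; rewrite !ffunE. Qed.

Lemma endo_compf1 : right_id endo_id endo_comp.
Proof. by move=> f; apply/val_inj/ffunP => x; rewrite !ffunE. Qed.

HB.instance Definition _ :=
  isMonoid.Build endo endo_compA endo_comp1f endo_compf1.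

End Endomorphisms.

Definition connected_in (G : sgraph) (S : {set G}) : Prop :=
  {in S &, forall x y,
    connect [rel u v | [&& u \in S, v \in S & edge u v]] x y}.

(* [B x] is the branch set contracted to the vertex [x] of [H]. *)
Definition is_minor (H G : sgraph) : Prop :=
  exists B : H -> {set G},
    [/\ forall x, B x != set0,
        forall x, connected_in (B x),
        forall x y, x != y -> [disjoint B x & B y]
      & forall x y, edge x y ->
          exists u v, [/\ u \in B x, v \in B y & edge u v]].

Definition excludes_minor (C : sgraph -> Prop) : Prop :=
  exists H : sgraph, forall G : sgraph, C G -> ~ is_minor H G.

Definition End_universal
    (C : sgraph -> Prop) (MM : finMonoidType -> Prop) : Prop :=
  forall M : finMonoidType, MM M ->
    exists2 G : sgraph, C G & monoid_iso M (endo G).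

Section Hypercube.
Variable n : nat.

Definition hypercube_edge : rel {ffun 'I_n -> bool} :=
  fun x y => #|[set i | x i != y i]| == 1.

Lemma hypercube_sym : symmetric hypercube_edge.
Proof.
move=> x y; rewrite /hypercube_edge; congr (#|pred_of_set _| == 1).
by apply/setP => i; rewrite !inE eq_sym.
Qed.

Lemma hypercube_irrefl : irreflexive hypercube_edge.
Proof.
move=> x; rewrite /hypercube_edge (_ : [set i | _] = set0) ?cards0 //.
by apply/setP => i; rewrite !inE eqxx.
Qed.

Definition hypercube : sgraph := SGraph hypercube_sym hypercube_irrefl.

End Hypercube.

(* Main.v *)
Require Import Defs.
From HB Require Import structures.
From mathcomp Require Import all_boot all_order.

Set Implicit Arguments.
Unset Strict Implicit.
Unset Printing Implicit Defensive.

Import Order.DefaultSetSubsetOrder Order.TTheory.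

(**
If [End G] is isomorphic to a lattice [(L, meet)], every endomorphism is a
retraction, and [a <= b] in [L] iff the image of [a] lies in the image of [b].
Take for [L] the lattice of downsets of the Boolean poset of subsets of the
vertex set of [H], and let [I X] ([skel X]) be the image attached to the
principal downset of [X].  The sets [B x = I {x} - I {}] ([node x]) are connected
and pairwise disjoint, and every component [K] of
[F x y = I {x, y} - (I {x} + I {y})] ([link x y]) has an edge to both [B x] and
[B y].  Indeed, if [K] had no edge to [B y], then keeping [K] and sending the
rest of [I {x, y}] to [I {x}] would be an endomorphism with image [K + I {x}];
but a downset below that of [{x, y}] either contains [{y}] or lies below that of
[{x}], and neither fits this image.  Attaching each [F x y] to the smaller of
its two ends turns the [B x] into the branch sets of a complete minor on the
vertices of [H].  For the first claim, [H] is the hypercube itself.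
*)

(** * The distributive lattice of downsets of a Boolean poset *)

Section Downsets.
Local Open Scope order_scope.
Variable T : finType.

Definition downclosed : {pred {set {set T}}} :=
  [pred D : {set {set T}} | [forall X in D, powerset X \subset D]].

Lemma downclosedP (D : {set {set T}}) :
  reflect (forall X Y : {set T}, X \in D -> Y \subset X -> Y \in D)
          (D \in downclosed).
Proof.
apply: (iffP forall_inP) => h X.
  by move=> Y XD YX; apply: (subsetP (h X XD)); rewrite powersetE.
by move=> XD; apply/subsetP => Y; rewrite powersetE; apply: h.
Qed.

Record downset := Downset {
  dset :> {set {set T}};
  dset_closed : dset \in downclosed
}.

HB.instance Definition _ := [isSub for dset].
HB.instance Definition _ := [Finite of downset by <:].

Lemma downclosedI : meet_closed downclosed.
Proof.
move=> A B /downclosedP hA /downclosedP hB; apply/downclosedP => X Y.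
by rewrite !inE => /andP[/hA XA /hB XB] YX; rewrite XA ?XB.
Qed.

Lemma downclosedU : join_closed downclosed.
Proof.
move=> A B /downclosedP hA /downclosedP hB; apply/downclosedP => X Y.
by rewrite !inE => /orP[/hA XA|/hB XB] YX; rewrite ?XA ?XB ?orbT.
Qed.

Lemma downclosed0 : \bot \in downclosed.
Proof. by apply/downclosedP => X Y; rewrite inE. Qed.

Lemma downclosed1 : \top \in downclosed.
Proof. by apply/downclosedP => X Y; rewrite !inE. Qed.

HB.instance Definition _ := Order.SubChoice_isTBSubLattice.Build
  _ _ _ (Order.Disp tt tt) downset
  downclosedI downclosedU downclosed0 downclosed1.

Lemma downset_meetUl :
  left_distributive (@Order.meet _ downset) (@Order.join _ downset).
Proof. by move=> A B C; apply: val_inj; exact: meetUl. Qed.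

HB.instance Definition _ :=
  Order.Lattice_Meet_isDistrLattice.Build _ downset downset_meetUl.

Lemma simplex_closed (X : {set T}) : powerset X \in downclosed.
Proof.
apply/downclosedP => Y Z; rewrite !powersetE => YX ZY; exact: subset_trans YX.
Qed.

Definition simplex (X : {set T}) : downset := Downset (simplex_closed X).

Lemma boundary_closed (X : {set T}) : powerset X :\ X \in downclosed.
Proof.
apply/downclosedP => Y Z; rewrite !inE => /andP[YX sYX] ZY.
rewrite (subset_trans ZY sYX) andbT; apply: contraNneq YX => eZX.
by rewrite eqEsubset sYX -eZX.
Qed.

(** The largest downset strictly below the join-irreducible [simplex X]. *)
Definition boundary (X : {set T}) : downset := Downset (boundary_closed X).

Lemma le_downset (A B : downset) : (A <= B) = (dset A \subset dset B).
Proof. by []. Qed.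

Lemma simplex_le (X : {set T}) (A : downset) :
  (simplex X <= A) = (X \in dset A).
Proof.
rewrite le_downset; apply/subsetP/idP => [|XA Y].
  by apply; rewrite powersetE.
by rewrite powersetE; apply: (downclosedP _ (dset_closed A)).
Qed.

Lemma simplexI (X Y : {set T}) : simplex X `&` simplex Y = simplex (X :&: Y).
Proof. by apply/val_inj/setP => Z; rewrite !inE subsetI. Qed.

(** If [[set z]] is not in the downset [A], then no member of [A] contains [z]. *)
Lemma simplex_prime (X : {set T}) (z : T) (A : downset) :
  A <= simplex X -> simplex [set z] <= A \/ A <= simplex (X :\ z).
Proof.
rewrite simplex_le !le_downset => /subsetP AX.
have [zA|zA] := boolP ([set z] \in dset A); [by left|right].
apply/subsetP => Y YA; move: (AX _ YA); rewrite !powersetE subsetD1 => -> /=.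
apply: contra zA => zY; apply: (downclosedP _ (dset_closed A)) YA _.
by rewrite sub1set.
Qed.

Lemma simplex_boundary (X : {set T}) : ~~ (simplex X <= boundary X).
Proof. by rewrite simplex_le !inE eqxx. Qed.

Lemma boundary_ge (X Y : {set T}) : Y \proper X -> simplex Y <= boundary X.
Proof. by rewrite simplex_le !inE properEneq. Qed.

End Downsets.

(** * Images of endomorphisms as retracts *)

Section Retracts.
Local Open Scope order_scope.
Variables (d : Order.disp_t) (L : finTBLatticeType d) (G : sgraph).
Variable e : L -> endo G.
Hypothesis eI : forall a b, e (a `&` b) = endo_comp (e a) (e b).
Hypothesis e_bij : bijective e.

(** Since [e a] is idempotent, its fixed points form its image. *)
Definition retract (a : L) : {set G} := [set v | e a v == v].

Lemma endo_meet a b v : e (a `&` b) v = e a (e b v).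
Proof. by rewrite eI ffunE. Qed.

Lemma endo_edge (f : endo G) u v : edge u v -> edge (f u) (f v).
Proof. exact: (is_endoP _ (valP f)). Qed.

Lemma endo_retract a v : e a v \in retract a.
Proof. by rewrite inE -endo_meet meetxx. Qed.

Lemma retractI a b : retract (a `&` b) = retract a :&: retract b.
Proof.
apply/setP => v; rewrite !inE; apply/eqP/andP => [h|[/eqP ha /eqP hb]].
  split; rewrite -[in X in _ == X]h -{1}h -endo_meet.
    by rewrite meetA meetxx.
  by rewrite meetCA meetxx.
by rewrite endo_meet hb ha.
Qed.

(** If [e b] fixes the image of [e a], then [e b] after [e a] is [e a], and injectivity of [e] makes
    [a] the meet of [a] and [b]. *)
Lemma retract_sub a b : (retract a \subset retract b) = (a <= b).
Proof.
apply/idP/idP => [/subsetP sab|/meet_idPl ab]; last first.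
  by rewrite -ab retractI subsetIr.
rewrite leEmeet meetC; apply/eqP/(bij_inj e_bij)/val_inj/ffunP => v.
by rewrite endo_meet; apply/eqP; have := sab _ (endo_retract a v); rewrite inE.
Qed.

(** After [e q], the map [g] keeps [K] and applies [e p] elsewhere. Edges survive because an edge
    leaving [K] inside [retract q] ends in [retract p], where [e p] is the identity. *)
Lemma fold_retract (p q : L) (K : {set G}) :
    p <= q -> K \subset retract q ->
    (forall u w, u \in K -> w \in retract q -> w \notin K -> edge u w ->
       w \in retract p) ->
  exists2 a, a <= q & retract a = K :|: retract p.
Proof.
move=> pq /subsetP Kq hK.
have spq : retract p \subset retract q by rewrite retract_sub.
pose g v := if e q v \in K then e q v else e p (e q v).
have half u w : e q u \in K -> e q w \notin K -> edge (e q u) (e q w) ->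
    edge (g u) (g w).
  move=> uK wK uw; rewrite /g uK (negPf wK).
  by have := hK _ _ uK (endo_retract q w) wK uw; rewrite inE => /eqP->.
have gP : is_endo [ffun v => g v].
  apply/is_endoP => u w /(endo_edge (e q)) uw; rewrite !ffunE.
  have [uK|uK] := boolP (e q u \in K); have [wK|wK] := boolP (e q w \in K).
  - by rewrite /g uK wK.
  - exact: half.
  - by rewrite edge_sym; apply: half; rewrite // edge_sym.
  - by rewrite /g (negPf uK) (negPf wK); apply: endo_edge.
(* By surjectivity of [e], the endomorphism just built comes from a lattice element. *)
have [e' _ e'K] := e_bij; pose a := e' (Endo gP).
have aE v : e a v = g v by rewrite e'K ffunE.
have ret_a : retract a = K :|: retract p.
  apply/setP => v; rewrite inE in_setU aE /g; apply/eqP/orP => [|[vK|vp]].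
  - by case: ifP => [? <-|_ <-]; [left|right; apply: endo_retract].
  - by have := Kq _ vK; rewrite inE => /eqP ->; rewrite vK.
  (* Here [v] may also lie in [K]; both cases of [g] fix it. *)
  - have := subsetP spq _ vp; move: vp; rewrite !inE => /eqP vp /eqP->.
    by rewrite vp; case: ifP.
exists a => //; rewrite -retract_sub ret_a subUset spq andbT.
exact/subsetP.
Qed.

End Retracts.

(** * Connected components of induced subgraphs *)

Section Components.
Variable G : sgraph.
Implicit Types S : {set G}.

Definition restrict S : rel G := [rel u v | [&& u \in S, v \in S & edge u v]].

Lemma connect_restrict_sym S : connect_sym (restrict S).
Proof.
by apply: sym_connect_sym => u v; rewrite /restrict /= edge_sym andbCA.
Qed.

Lemma connect_restrictS S S' u v :
  S \subset S' -> connect (restrict S) u v -> connect (restrict S') u v.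
Proof.
move=> /subsetP SS'; apply: connect_sub => x y /= /and3P[xS yS xy].
by apply: connect1; rewrite /restrict /= !SS'.
Qed.

(** For [v] outside [S] this is the singleton of [v], not the empty set. *)
Definition component S v : {set G} := [set w | connect (restrict S) v w].

Lemma component_sub S v : v \in S -> component S v \subset S.
Proof.
move=> vS; apply/subsetP => w; rewrite inE => /connectP[p].
elim/last_ind: p => [_ -> //|p x _]; rewrite rcons_path last_rcons.
by case/andP => _ /and3P[_ xS _] ->.
Qed.

Lemma component_refl S v : v \in component S v.
Proof. by rewrite inE. Qed.

Lemma component_edge S v u w :
  v \in S -> u \in component S v -> w \in S -> edge u w -> w \in component S v.
Proof.
move=> vS uK wS uw; have uS := subsetP (component_sub vS) _ uK.
move: uK; rewrite !inE => /connect_trans; apply; apply: connect1.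
by rewrite /restrict /= uS wS.
Qed.

End Components.

(** * Branch sets of the minor *)

Section BranchSets.
Local Open Scope order_scope.
Variables (H G : sgraph) (e : downset H -> endo G).
Hypothesis eI : forall a b, e (a `&` b) = endo_comp (e a) (e b).
Hypothesis e_bij : bijective e.
Implicit Types (x y : H) (X Y : {set H}) (v w : G).

Definition skel X : {set G} := retract e (simplex X).

Lemma skelI X Y : skel X :&: skel Y = skel (X :&: Y).
Proof. by rewrite /skel -retractI // simplexI. Qed.

Lemma skelS X Y : X \subset Y -> skel X \subset skel Y.
Proof. by move/setIidPl <-; rewrite -skelI subsetIr. Qed.

(** The image of [boundary X] is strictly smaller than [skel X] and contains [skel Y] for every
    proper subset [Y]. *)
Lemma skel_interior X :
  exists2 v, v \in skel X & forall Y, Y \proper X -> v \notin skel Y.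
Proof.
have: ~~ (skel X \subset retract e (boundary X)).
  by rewrite retract_sub // simplex_boundary.
case/subsetPn => v vX vb; exists v => // Y YX; apply: contra vb.
by apply/subsetP; rewrite retract_sub // boundary_ge.
Qed.

Definition node x : {set G} := skel [set x] :\: skel set0.
Definition link x y : {set G} :=
  skel [set x; y] :\: (skel [set x] :|: skel [set y]).

Lemma linkC x y : link x y = link y x.
Proof. by rewrite /link setUC [_ :|: skel _]setUC. Qed.

Lemma node_neq0 x : exists v, v \in node x.
Proof.
have [v vx vP] := skel_interior [set x]; exists v.
by rewrite inE vx vP // properEcard sub0set cards0 cards1.
Qed.

Lemma link_neq0 x y : x != y -> exists v, v \in link x y.
Proof.
move=> xy; have [v vxy vP] := skel_interior [set x; y]; exists v.
have pr z : z \in [set x; y] -> [set z] \proper [set x; y].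
  by move=> zxy; rewrite properEcard sub1set zxy cards1 cards2 xy.
by rewrite inE vxy andbT in_setU negb_or !vP ?pr ?inE ?eqxx ?orbT.
Qed.

(** Folding everything but a component [K] onto [skel set0] gives a lattice element below [simplex
    [set x]]. It is not below [simplex set0], since [K] is nonempty, so its image is all of [skel
    [set x]] and [K] is the whole node. *)
Lemma node_connected x : connected_in (node x).
Proof.
move=> v w vx wx; pose K := component (node x) v.
have Kx : K \subset node x by apply: component_sub.
have [||u t uK tx tK ut|a ax aE] :=
  @fold_retract _ _ _ e eI e_bij (simplex set0) (simplex [set x]) K.
- by rewrite -(retract_sub eI e_bij); apply/skelS/sub0set.
- exact: subset_trans Kx (subsetDl _ _).
- apply: contraR tK => to; apply: component_edge uK _ ut => //.
  by rewrite inE to.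
suff: w \in K by rewrite inE.
have [xa|] := simplex_prime x ax.
  move: xa; rewrite -(retract_sub eI e_bij) aE => /subsetP/(_ w).
  move: wx; rewrite !in_setD in_setU => /andP[/negPf-> ->].
  by rewrite orbF; apply.
rewrite setDv -(retract_sub eI e_bij) aE => /subsetP/(_ v).
by rewrite in_setU component_refl => /(_ isT) vo; move: vx; rewrite inE vo.
Qed.

Lemma link_node x y v : x != y -> v \in link x y ->
  exists u w, [/\ u \in component (link x y) v, w \in node y & edge u w].
Proof.
move=> xy vxy; pose K := component (link x y) v.
have KF : K \subset link x y by apply: component_sub.
have [/existsP[u /existsP[w /and3P[]]]|none] :=
  boolP [exists u, exists w, [&& u \in K, w \in node y & edge u w]].
  by exists u, w.
have sx : [set x] \subset [set x; y] by rewrite sub1set !inE eqxx.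
have [||u t uK txy tK ut|a axy aE] :=
  @fold_retract _ _ _ e eI e_bij (simplex [set x]) (simplex [set x; y]) K.
- by rewrite -(retract_sub eI e_bij); apply: skelS.
- exact: subset_trans KF (subsetDl _ _).
(* A neighbour [t] outside [K] and [skel [set x]] cannot lie in the link, so it lies in [node y],
   against [none]. *)
- apply: contraNT none => tx; apply/existsP; exists u; apply/existsP; exists t.
  rewrite uK ut andbT /= inE; apply/andP; split.
    by apply: contra tx; apply/subsetP/skelS/sub0set.
  apply: contraR tK => ty; apply: component_edge uK _ ut => //.
  by rewrite inE in_setU negb_or tx ty.
have vK : v \in K by apply: component_refl.
(* Either the image contains [node y], which misses both [K] and [skel [set x]], or it lies in [skel
   [set x]], which misses [v]. *)
have [|] := simplex_prime y axy; rewrite -(retract_sub eI e_bij) aE => sub.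
  have [w] := node_neq0 y; rewrite inE => /andP[wo wy].
  have := subsetP sub _ wy; rewrite inE => /orP[/(subsetP KF)|wx].
    by rewrite inE in_setU wy orbT.
  case/negP: wo; apply: (subsetP (_ : skel ([set x] :&: [set y]) \subset _)).
    by apply: skelS; rewrite (disjoint_setI0 _) // disjoints1 inE.
  by rewrite -skelI inE wx wy.
have /(subsetP KF) := vK.
rewrite in_setD in_setU negb_or => /andP[/andP[vx _] _].
case/negP: vx; apply: (subsetP (_ : skel ([set x; y] :\ y) \subset _)).
  apply/skelS/subsetP => z; rewrite !inE.
  by case: (z == y); rewrite ?orbF.
by apply: (subsetP sub); rewrite in_setU vK.
Qed.

(** An arbitrary strict total order, deciding which end owns a link. *)
Let before : rel H := fun x y => enum_rank x < enum_rank y.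

Definition branch x : {set G} := node x :|: \bigcup_(y | before x y) link x y.

Lemma node_branch x : node x \subset branch x.
Proof. exact: subsetUl. Qed.

Lemma link_branch x y : before x y -> link x y \subset branch x.
Proof. by move=> xy; apply/subsetU/orP; right; apply: bigcup_sup. Qed.

Lemma before_neq x y : before x y -> x != y.
Proof. by apply: contraTneq => ->; rewrite /before ltxx. Qed.

Lemma branch_connected x : connected_in (branch x).
Proof.
have toB v : v \in branch x ->
    exists2 w, w \in node x & connect (restrict (branch x)) v w.
  rewrite in_setU => /orP[vx|/bigcupP[y xy vxy]]; first by exists v.
  (* The ends are exchanged so that [link_node] leads into [node x], the node of the owner. *)
  have vyx : v \in link y x by rewrite linkC.
  have yx : y != x by rewrite eq_sym before_neq.
  have [u [w [uK wx uw]]] := link_node yx vyx; exists w => //.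
  have uF := subsetP (component_sub vyx) _ uK; move: uK; rewrite linkC in uF *.
  rewrite inE => /(connect_restrictS (link_branch xy))/connect_trans; apply.
  apply: connect1; rewrite /restrict /= uw.
  by rewrite (subsetP (link_branch xy)) ?(subsetP (node_branch x)).
move=> v w /toB[v' v'x vv'] /toB[w' w'x ww'].
apply: connect_trans vv' _; rewrite connect_restrict_sym.
apply: connect_trans ww' _; apply: connect_restrictS (node_branch x) _.
exact: node_connected.
Qed.

(** By [skelI], a minimal set whose skeleton contains [v] is unique; the case [y = x] stands for
    vertices of [node x]. *)
Lemma branchP x v : v \in branch x ->
  exists2 y, y = x \/ before x y &
    v \in skel [set x; y] /\ forall Y, Y \proper [set x; y] -> v \notin skel Y.
Proof.
rewrite in_setU => /orP[|/bigcupP[y xy]]; rewrite inE => /andP[vN vX].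
  exists x; [by left|rewrite setUid; split => // Y].
  rewrite properEneq subset1 => /andP[/negPf-> /=] /eqP->; exact: vN.
exists y; [by right|split => // Y /properP[sY [z zxy zY]]].
move: vN; rewrite in_setU; apply: contra => vY.
have YD : Y \subset [set x; y] :\ z by rewrite subsetD1 sY zY.
have sub t : [set x; y] :\ z \subset [set t] -> v \in skel [set t].
  by move=> st; apply: subsetP vY; apply/skelS/(subset_trans YD).
(* Removing one end [z] of the pair leaves at most the other. *)
move: zxy; rewrite in_set2 => /orP[]/eqP zE; apply/orP; [right|left];
  apply: sub; apply/subsetP => t; rewrite !inE zE;
  by case: (t == x) => //; case: (t == y).
Qed.

(** A common vertex has one minimal set, so the two pairs coincide; then [x] and [y] are the ends of
    one link, each preceding the other. *)
Lemma branch_disjoint x y : x != y -> [disjoint branch x & branch y].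
Proof.
move=> xNy; rewrite -setI_eq0; apply/set0Pn => -[v].
rewrite in_setI => /andP[/branchP[x' xx' [vx vxP]] /branchP[y' yy' [vy vyP]]].
have vI : v \in skel ([set x; x'] :&: [set y; y']) by rewrite -skelI inE vx.
have eqx : [set x; x'] :&: [set y; y'] = [set x; x'].
  apply/eqP; apply: contraLR vI => h; apply: vxP.
  by rewrite properEneq h subsetIl.
have eqy : [set x; x'] :&: [set y; y'] = [set y; y'].
  apply/eqP; apply: contraLR vI => h; apply: vyP.
  by rewrite properEneq h subsetIr.
have e2 : [set x; x'] = [set y; y'] by rewrite -eqx eqy.
have xy : before y x.
  have: x \in [set y; y'] by rewrite -e2 !inE eqxx.
  rewrite !inE (negPf xNy) /= => /eqP xE; case: yy'; rewrite -xE // => xy.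
  by rewrite xy eqxx in xNy.
have yx : before x y.
  have: y \in [set x; x'] by rewrite e2 !inE eqxx.
  rewrite !inE eq_sym (negPf xNy) /= => /eqP yE.
  case: xx'; rewrite -yE // => yx.
  by rewrite yx eqxx in xNy.
by have := lt_trans xy yx; rewrite ltxx.
Qed.

Lemma minor_of_downset_End : is_minor H G.
Proof.
exists branch; split; [|exact: branch_connected|exact: branch_disjoint|].
  move=> x; have [v vx] := node_neq0 x; apply/set0Pn; exists v.
  exact: (subsetP (node_branch _)).
have adj x y : before x y ->
    exists u v, [/\ u \in branch x, v \in branch y & edge u v].
  move=> xy; have xNy := before_neq xy; have [v vxy] := link_neq0 xNy.
  (* The component of [v] lies in [branch x] and has an edge into [node y]. *)
  have [u [w [uK wy uw]]] := link_node xNy vxy; exists u, w; split => //.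
    exact: (subsetP (link_branch xy)) (subsetP (component_sub vxy) _ uK).
  exact: (subsetP (node_branch y)).
move=> x y xy.
have: x != y by apply: contraTneq xy => ->; rewrite edge_irrefl.
rewrite -(inj_eq enum_rank_inj) neq_lt => /orP[|/adj[u [v [uy vx uv]]]].
  exact: adj.
by exists v, u; rewrite edge_sym.
Qed.

End BranchSets.

(** * Hypercube minors and failure of universality *)

Theorem theorem3 :
  (forall n : nat, 0 < n ->
     exists (d : Order.disp_t) (L : finTBDistrLatticeType d),
       forall G : sgraph,
         monoid_iso (endo G) (meet_monoid L) -> is_minor (hypercube n) G) /\
  (forall C : sgraph -> Prop,
     excludes_minor C -> ~ End_universal C comm_idem_monoid).
Proof.
split=> [n _ | C [H HC] univ].
  exists _, (downset (hypercube n)) => G [phi [_ phiM] phi_bij].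
  have [psi phiK psiK] := phi_bij.
  apply: (minor_of_downset_End (e := psi)); last by exists phi.
  by move=> a b; apply: (can_inj phiK); rewrite phiM !psiK.
(* The monoid is built from the excluded graph [H] itself, so that any graph representing it has [H]
   as a minor. *)
pose M : finMonoidType := meet_monoid (downset H).
have MP : comm_idem_monoid M by split; [apply: meetC | apply: meetxx].
have [G CG [phi [_ phiM] phi_bij]] := univ M MP.
by apply: (HC G CG); apply: (minor_of_downset_End (e := phi)).
Qed.
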